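(* Let $\mathfrak p$ be a regular $T_0$-property (of unordered hypergraphs), and let $m\ge 0$, $n\ge 1$ be integers. Then $$\alpha^\ast_{\mathfrak p}(m,n)=\sum_{i=1}^{n}s_{n,i}\,\alpha_{\mathfrak p}(m,n;i),$$ where $s_{n,i}$ are the (signed) Stirling numbers of the first kind.
   Context: An unordered (labelled) $(m,n)$-hypergraph $H$ consists of a linearly ordered vertex set $V=\{V[1]<\dots<V[n]\}$ with $n\ge1$ elements together with an unordered finite family of $m$ subsets of $V$, called edges; edges may be empty and may repeat, so the family is a multiset of $m$ subsets of $V$. Two such hypergraphs are identified if the order-preserving bijection of their vertex sets carries one family of edges to the other (with multiplicities), so one counts $(m,n)$-hypergraphs on a fixed linearly ordered $n$-set. An unordered hypergraph property is a property of such hypergraphs, invariant under this identification. For vertices $u,v$ of $H$ write $u\sim_H v$ if every edge of $H$ contains either both or neither of $u,v$. $H$ is a $T_0$-hypergraph if $u\not\sim_H v$ for all distinct vertices $u,v$. $\alpha^\ast_{\mathfrak p}(m,n)$ is the number of $(m,n)$-hypergraphs that have property $\mathfrak p$ and are $T_0$-hypergraphs. For a partition $\pi$ of $\{1,\dots,n\}$, $\alpha_{\mathfrak p}(m,n;\pi)$ is the number of $(m,n)$-hypergraphs $H$ with property $\mathfrak p$ such that $V[i]\sim_H V[j]$ whenever $i,j$ lie in the same class of $\pi$. The type of a partition $\pi$ of an $n$-set is $\tau=(\alpha_1,\dots,\alpha_n)$, where $\alpha_i$ is the number of classes of cardinality $i$, and $|\tau|=\alpha_1+\dots+\alpha_n$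 is the number of classes. The property $\mathfrak p$ is uniform if $\alpha_{\mathfrak p}(m,n;\pi)$ depends (for given $m,n$) only on the type $\tau$ of $\pi$; then write $\alpha_{\mathfrak p}(m,n;\tau)$. A uniform property $\mathfrak p$ is a regular $T_0$-property if $|\tau|=|\tau'|=k$ always implies $\alpha_{\mathfrak p}(m,n;\tau)=\alpha_{\mathfrak p}(m,n;\tau')$; the common value is denoted $\alpha_{\mathfrak p}(m,n;k)$. The signed Stirling numbers of the first kind are defined by $x(x-1)\cdots(x-n+1)=\sum_{i=0}^n s_{n,i}x^i$. *)

(* Defs.v *)
From HB Require Import structures.
From mathcomp Require Import all_boot all_order all_algebra.

Set Implicit Arguments.
Unset Strict Implicit.
Unset Printing Implicit Defensive.

Import GRing.Theory.

(* The linearly ordered n-set of vertices is 'I_n, with V[i.+1] represented by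
   i : 'I_n.  The multiset of edges is given by its multiplicity function;
   a multiplicity cannot exceed the total number m of edges, so values are
   taken in 'I_m.+1, which makes the type of (m, n)-hypergraphs finite. *)
Record hypergraph (m n : nat) := Hypergraph {
  mult :> {ffun {set 'I_n} -> 'I_m.+1};
  mult_sum : \sum_(A : {set 'I_n}) mult A == m
}.

HB.instance Definition _ m n := [isSub for @mult m n].
HB.instance Definition _ m n := [Finite of hypergraph m n by <:].

Definition is_edge m n (H : hypergraph m n) (A : {set 'I_n}) : bool :=
  0 < H A.

Definition hsim m n (H : hypergraph m n) (u v : 'I_n) : bool :=
  [forall (A | is_edge H A), (u \in A) == (v \in A)].

Definition T0_hypergraph m n (H : hypergraph m n) : bool :=
  [forall u, forall v, (u != v) ==> ~~ hsim H u v].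

Definition hproperty := forall m n, pred (hypergraph m n).

Definition alpha_star (p : hproperty) m n : nat :=
  #|[set H : hypergraph m n | p m n H && T0_hypergraph H]|.

Definition is_partition n (P : {set {set 'I_n}}) : bool :=
  partition P [set: 'I_n].

Definition alpha_part (p : hproperty) m n (P : {set {set 'I_n}}) : nat :=
  #|[set H : hypergraph m n | p m n H &&
      [forall B in P, forall i in B, forall j in B, hsim H i j]]|.

(* The component of index i : 'I_n of a type is alpha_(i+1), the number of
   classes of cardinality i.+1. *)
Definition part_type n (P : {set {set 'I_n}}) : {ffun 'I_n -> nat} :=
  [ffun i : 'I_n => #|[set B in P | #|B| == i.+1]|].

Definition type_size n (t : {ffun 'I_n -> nat}) : nat := \sum_i t i.

Definition is_type n (t : {ffun 'I_n -> nat}) : bool :=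
  [exists P : {set {set 'I_n}}, is_partition P && (part_type P == t)].

Definition uniform_property (p : hproperty) : Prop :=
  forall m n (P Q : {set {set 'I_n}}), 0 < n ->
    is_partition P -> is_partition Q -> part_type P = part_type Q ->
    alpha_part p m P = alpha_part p m Q.

(* Common value of alpha_part on the partitions of type t when p is uniform
   (see alpha_typeE); 0 if t is not the type of a partition. *)
Definition alpha_type (p : hproperty) m n (t : {ffun 'I_n -> nat}) : nat :=
  if [pick P : {set {set 'I_n}} | is_partition P && (part_type P == t)]
    is Some P then alpha_part p m P else 0.

Definition regular_T0_property (p : hproperty) : Prop :=
  uniform_property p /\
  forall m n (t t' : {ffun 'I_n -> nat}), 0 < n ->
    is_type t -> is_type t' -> type_size t = type_size t' ->
    alpha_type p m t = alpha_type p m t'.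

(* Common value of alpha_type on the types t with |t| = k when p is regular
   (see alpha_classesE); 0 if there is no such type, i.e. unless 1 <= k <= n
   when n > 0. *)
Definition alpha_classes (p : hproperty) m n (k : nat) : nat :=
  if [pick P : {set {set 'I_n}} |
       is_partition P && (type_size (part_type P) == k)]
    is Some P then alpha_type p m (part_type P) else 0.

Lemma alpha_typeE p m n (P : {set {set 'I_n}}) :
  uniform_property p -> 0 < n -> is_partition P ->
  alpha_type p m (part_type P) = alpha_part p m P.
Proof.
move=> up n0 hP; rewrite /alpha_type; case: pickP => [Q /andP[hQ /eqP e]|/(_ P)].
  exact: up.
by rewrite hP eqxx.
Qed.

Lemma alpha_classesE p m n (t : {ffun 'I_n -> nat}) :
  regular_T0_property p -> 0 < n -> is_type t ->
  alpha_classes p m n (type_size t) = alpha_type p m t.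
Proof.
move=> [_ rp] n0 ht; rewrite /alpha_classes.
case: pickP => [Q /andP[hQ /eqP e]|h].
  by apply: rp => //; apply/existsP; exists Q; rewrite hQ eqxx.
by have /existsP[P /andP[hP /eqP e]] := ht; move: (h P); rewrite hP e eqxx.
Qed.

Local Open Scope ring_scope.

Definition stirling1 (n i : nat) : int :=
  (\prod_(j < n) ('X - (j%:Z)%:P) : {poly int})`_i.

(* Main.v *)
(* Since the signs of the permutations preserving every fibre of f sum to 1 when
   f is injective and cancel in pairs otherwise, the T_0-condition on H is
   encoded by the sum of the signs of the s with V[i] ~_H V[s i] for all i, that
   is, those for which H is compatible with the cycle partition of s.  Hence
   alpha^* is the sum over s of sgn s * alpha (number of cycles of s).  Counting
   the injections into k colours in the same way gives
   sum_s sgn s * k^(number of cycles of s) = k (k - 1) ... (k - n + 1)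
   for all k, which identifies the coefficients with the Stirling numbers. *)
Require Import Defs.
From mathcomp Require Import all_boot all_order all_algebra.
From mathcomp Require Import fingroup perm action zify.

Set Implicit Arguments.
Unset Strict Implicit.
Unset Printing Implicit Defensive.

Import GRing.Theory Num.Theory.

Local Open Scope ring_scope.

Lemma sum_sign_fibre_perm (T : finType) (R : eqType) (f : T -> R) :
  \sum_(s : {perm T} | [forall x, f (s x) == f x]) (-1) ^+ s
    = (injectiveb f)%:Z.
Proof.
have [/injectiveP injf | /injectivePn [u [v nuv fuv]]] := boolP (injectiveb f).
  rewrite (big_pred1 1%g) ?odd_perm1 // => s /=.
  apply/forallP/eqP => [fs | -> x]; last by rewrite perm1.
  by apply/permP => x; rewrite perm1; apply: injf; apply/eqP.
have ft x : f (tperm u v x) = f x by case: tpermP => // ->.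
(* Left multiplication by [tperm u v], for a pair with [f u = f v], permutes the index set and flips
   every sign. *)
set S := LHS; suff: S = - S by lia.
rewrite {1}/S (reindex_inj (mulgI (tperm u v))) /= /S -sumrN.
apply: eq_big => [s | s _]; last first.
  by rewrite odd_mul_tperm nuv signr_addb mulN1r.
apply/forallP/forallP => fs x; last by rewrite permM (eqP (fs _)) ft.
by have /eqP := fs (tperm u v x); rewrite permM tpermK ft => ->.
Qed.

Lemma porbit_invariant (T : finType) (R : Type) (f : T -> R) (s : {perm T}) :
  (forall x, f (s x) = f x) -> forall x y, y \in porbit s x -> f y = f x.
Proof.
move=> fs x y /porbitP[i ->]; elim: i => [|i IHi]; first by rewrite expg0 perm1.
by rewrite expgSr permM fs.
Qed.

Lemma porbit_in_porbits (T : finType) (s : {perm T}) (x : T) :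
  porbit s x \in porbits s.
Proof. exact: imset_f. Qed.

(** An invariant function is constant on every cycle of [s], so it amounts to a free choice of one
    value per cycle. *)
Lemma card_invariant_ffun (T R : finType) (s : {perm T}) :
  #|[set f : {ffun T -> R} | [forall x, f (s x) == f x]]|
    = (#|R| ^ #|porbits s|)%N.
Proof.
pose Q := {B : {set T} | B \in porbits s}.
pose q x : Q := exist _ (porbit s x) (porbit_in_porbits s x).
(* [r] picks a representative of each cycle: it makes [lift_orb] injective and turns an invariant
   [f] into a function on cycles. *)
have [r rK] : exists r : Q -> T, cancel r q.
  have ex (B : Q) : exists x, q x == B.
    by case: B => B /[dup] /imsetP[x _ ->] xs; exists x; apply/eqP/val_inj.
  by exists (fun B => xchoose (ex B)) => B; apply/eqP/(xchooseP (ex B)).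
rewrite -(card_sig (mem (porbits s))) -card_ffun.
pose lift_orb (g : {ffun Q -> R}) : {ffun T -> R} := [ffun x => g (q x)].
have lift_orb_inj : injective lift_orb.
  move=> g h /ffunP gh; apply/ffunP => B.
  by have := gh (r B); rewrite !ffunE rK.
rewrite -cardsT -(card_imset _ lift_orb_inj); apply: eq_card => f; rewrite inE.
apply/forallP/imsetP => [fs | [g _ ->] x]; last first.
  rewrite !ffunE; apply/eqP; congr (g _); apply: val_inj => /=.
  by apply/eqP; rewrite eq_porbit_mem; have := mem_porbit s 1 x; rewrite expg1.
exists [ffun B => f (r B)] => //; apply/ffunP => x; rewrite !ffunE.
apply: porbit_invariant => [y|]; first exact/eqP.
by rewrite -eq_porbit_mem; have /(congr1 val) /= -> := rK (q x).
Qed.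

Lemma horner_inj_nat (p q : {poly int}) :
  (forall k : nat, p.[k%:Z] = q.[k%:Z]) -> p = q.
Proof.
move=> pq; apply/eqP; rewrite -subr_eq0; apply/negPn/negP => nz.
(* As many distinct roots as the size of a nonzero polynomial are one too many. *)
have := @max_poly_roots _ (p - q) [seq k%:Z | k <- iota 0 (size (p - q)%R)] nz.
rewrite size_map size_iota ltnn map_inj_uniq ?iota_uniq; last by move=> ? ? [].
move=> h; suff: false by []; apply: h => //.
by apply/allP => _ /mapP[k _ ->]; rewrite rootE !hornerE pq subrr.
Qed.

Lemma natz_ffact (k n : nat) : (k ^_ n)%:Z = \prod_(j < n) (k%:Z - j%:Z).
Proof.
elim: n => [|n IHn]; first by rewrite big_ord0.
rewrite big_ord_recr /= -IHn ffactnSr PoszM.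
(* For [k < n] the truncated [k - n] is not the integer difference, but then [k ^_ n] vanishes. *)
have [lenk | ltkn] := leqP n k; first by rewrite subzn.
by rewrite ffact_small // !mul0r.
Qed.

Lemma falling_poly_cycles (n : nat) :
  \prod_(j < n) ('X - (j%:Z)%:P) =
    \sum_(s : {perm 'I_n}) (-1) ^+ s *: 'X^#|porbits s| :> {poly int}.
Proof.
apply: horner_inj_nat => k; rewrite horner_prod horner_sum.
under eq_bigr do rewrite !hornerE.
under [RHS]eq_bigr do rewrite !hornerE.
rewrite -natz_ffact -{1}[k]card_ord -{1}[n]card_ord -card_inj_ffuns -sum1_card.
rewrite [LHS](_ : _ = \sum_(f : {ffun 'I_n -> 'I_k}) (injectiveb f)%:Z); last first.
  rewrite (big_morph Posz PoszD (erefl _)) big_mkcond /=.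
  by apply: eq_bigr => f _; rewrite inE; case: ifP.
under [LHS]eq_bigr do rewrite -sum_sign_fibre_perm.
(* For a fixed [s] there remain the colourings invariant under [s], one colour per cycle. *)
rewrite (exchange_big_dep predT) //=; apply: eq_bigr => s _.
rewrite sumr_const -mulr_natr; congr (_ * _).
rewrite -[k%:Z]natz -natrX -[in RHS](card_ord k) -card_invariant_ffun.
by congr _%:R; apply: eq_card => f; rewrite !inE.
Qed.

Lemma stirling1_cycles (n i : nat) :
  stirling1 n i = \sum_(s : {perm 'I_n} | #|porbits s| == i) (-1) ^+ s.
Proof.
rewrite /stirling1 falling_poly_cycles coef_sum [RHS]big_mkcond.
apply: eq_bigr => s _; rewrite coefZ coefXn eq_sym.
by case: eqP => _; rewrite ?mulr1 ?mulr0.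
Qed.

Lemma porbits_partition n (s : {perm 'I_n}) : is_partition (porbits s).
Proof.
rewrite /is_partition.
have -> : porbits s = orbit 'P <[s]> @: [set: 'I_n].
  rewrite /porbits porbitE.
  by apply/setP => B; apply/imsetP/imsetP => -[x _ ->]; exists x.
apply: orbit_partition.
by apply/actsP => a _ x; rewrite !inE.
Qed.

Lemma type_size_part_type n (P : {set {set 'I_n}}) :
  is_partition P -> type_size (part_type P) = #|P|.
Proof.
move=> /and3P[_ _ P0]; rewrite /type_size -sum1_card.
have class_gt0 B : B \in P -> (0 < #|B|)%N.
  by move=> BP; rewrite card_gt0; apply: contraNneq P0 => <-.
under eq_bigr do rewrite ffunE -sum1_card big_mkcond.
rewrite exchange_big [RHS]big_mkcond; apply: eq_bigr => B _.
under eq_bigr do rewrite inE.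
have [BP | _] := boolP (B \in P); last by rewrite big1.
have B0 := class_gt0 B BP.
(* Types are indexed from 0, so the class [B] is counted exactly once, at index [#|B|.-1]; this
   needs [B] nonempty. *)
have Bn : (#|B|.-1 < n)%N by rewrite prednK // -[leqRHS]card_ord max_card.
rewrite (bigD1 (Ordinal Bn)) //= prednK // eqxx big1 // => i ni.
case: eqP => // Bi; case/eqP: ni; apply: val_inj => /=; lia.
Qed.

Lemma alpha_part_classes p m n (P : {set {set 'I_n}}) :
  regular_T0_property p -> (0 < n)%N -> is_partition P ->
  alpha_part p m P = alpha_classes p m n #|P|.
Proof.
move=> rp n0 hP; rewrite -type_size_part_type // alpha_classesE //.
  by rewrite alpha_typeE //; case: rp.
by apply/existsP; exists P; rewrite hP eqxx.
Qed.

(** Turns [hsim H] into the fibre relation of a function, so that the signed sum over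
    fibre-preserving permutations applies to the T_0-condition. *)
Definition star m n (H : hypergraph m n) (u : 'I_n) : {set {set 'I_n}} :=
  [set A | is_edge H A && (u \in A)].

Lemma hsim_star m n (H : hypergraph m n) u v :
  hsim H u v = (star H u == star H v).
Proof.
apply/forall_inP/eqP => [uv | /setP uv A HA].
  by apply/setP => A; rewrite !inE; case: (boolP (is_edge H A)) => // /uv /eqP.
by have := uv A; rewrite !inE HA /= => ->.
Qed.

Lemma T0_hypergraph_star m n (H : hypergraph m n) :
  T0_hypergraph H = injectiveb (star H).
Proof.
apply/'forall_forallP/injectiveP => [T0 u v /eqP | inj u v].
  by rewrite -hsim_star; apply: contraTeq => nuv; have := T0 u v; rewrite nuv.
by apply/implyP; rewrite hsim_star; apply: contra_neqN => /eqP /inj.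
Qed.

Lemma hsim_porbits m n (H : hypergraph m n) (s : {perm 'I_n}) :
  [forall B in porbits s, forall i in B, forall j in B, hsim H i j]
    = [forall x, star H (s x) == star H x].
Proof.
apply/idP/forallP => [/forall_inP h x | h].
  have /forall_inP/(_ (s x)) := h _ (porbit_in_porbits s x).
  have sx : s x \in porbit s x by have := mem_porbit s 1 x; rewrite expg1.
  by move=> /(_ sx) /forall_inP/(_ x (porbit_id s x)); rewrite hsim_star.
apply/forall_inP => _ /imsetP[x _ ->]; apply/forall_inP => i xi.
apply/forall_inP => j xj; rewrite hsim_star.
have inv y : y \in porbit s x -> star H y = star H x.
  by apply: porbit_invariant => z; apply/eqP.
by rewrite !inv.
Qed.

Theorem theorem3p3 (p : hproperty) (m n : nat)
    (hp : regular_T0_property p) (hn : (0 < n)%N) :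
  (alpha_star p m n)%:Z =
    \sum_(1 <= i < n.+1) stirling1 n i * (alpha_classes p m n i)%:Z.
Proof.
transitivity
    (\sum_(s : {perm 'I_n}) (-1) ^+ s * (alpha_part p m (porbits s))%:Z).
  rewrite /alpha_star -sum1_card (big_morph Posz PoszD (erefl _)).
  under eq_bigl do rewrite inE.
  rewrite big_mkcondr /=.
  (* The T_0-indicator of each [H] becomes a signed sum; exchanging the sums leaves, for each [s],
     the hypergraphs compatible with its cycles. *)
  transitivity (\sum_(H : hypergraph m n | p m n H)
      \sum_(s : {perm 'I_n} | [forall x, star H (s x) == star H x])
         (-1) ^+ s : int).
    apply: eq_bigr => H _; rewrite sum_sign_fibre_perm -T0_hypergraph_star.
    by case: T0_hypergraph.
  rewrite (exchange_big_dep predT) //=; apply: eq_bigr => s _.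
  rewrite sumr_const -mulr_natr natz; congr (_ * _%:Z).
  by apply: eq_card => H; rewrite !inE hsim_porbits.
(* The cycle count lies in the summation range, which omits 0 because [n] is positive. *)
have porbits_bound (s : {perm 'I_n}) : (0 < #|porbits s| < n.+1)%N.
  apply/andP; split.
    by apply/card_gt0P; exists (porbit s (Ordinal hn)); apply: porbit_in_porbits.
  by rewrite ltnS -[leqRHS]card_ord; apply: leq_imset_card.
under [RHS]eq_big_nat do rewrite stirling1_cycles mulr_suml big_mkcond.
rewrite exchange_big; apply: eq_bigr => s _.
rewrite alpha_part_classes ?porbits_partition //.
(* Each [s] contributes only to the index equal to its number of cycles. *)
rewrite (bigD1_seq #|porbits s|) ?iota_uniq ?mem_index_iota //= eqxx.
by rewrite big1 ?addr0 // => i; rewrite eq_sym => /negPf->.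
Qed.
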